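(* Let $1\leq m<n$ be integers and let $\Omega\subset\mathbb{R}^n$ be open. If $f\in C^1(\Omega,\mathbb{R}^n)$ satisfies $\operatorname{rank} Df\leq m$ everywhere in $\Omega$, then there is an open and dense set $G\subset\Omega$ such that for every point $x\in G$ there are a neighborhood $\mathbb{B}^n(x,\varepsilon)\subset G$ (with some $\varepsilon>0$) and a sequence $f_i\in C^\infty(\mathbb{B}^n(x,\varepsilon),\mathbb{R}^n)$ such that $\operatorname{rank} Df_i\leq m$ everywhere in $\mathbb{B}^n(x,\varepsilon)$ for every $i$, and $f_i$ converges to $f$ uniformly on $\mathbb{B}^n(x,\varepsilon)$.
   Context: $\mathbb{B}^n(x,\varepsilon)$ denotes the open Euclidean ball in $\mathbb{R}^n$ with center $x$ and radius $\varepsilon$. $Df(x)$ denotes the derivative of $f$ at $x$, and $\operatorname{rank} Df(x)$ its rank as a linear map. Dense means dense in $\Omega$. *)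

(* Defs.v *)
From HB Require Import structures.
From mathcomp Require Export all_boot all_order all_algebra.
From mathcomp Require Export all_classical all_reals all_analysis.

Set Implicit Arguments.
Unset Strict Implicit.
Unset Printing Implicit Defensive.

Import Order.TTheory GRing.Theory Num.Theory.
Import numFieldNormedType.Exports.

Local Open Scope classical_set_scope.
Local Open Scope ring_scope.

(* The norm `|_| on 'rV[R]_n and its [ball] are those of the sup norm, hence
   these Euclidean versions. *)
Definition enorm (R : realType) (n : nat) (x : 'rV[R]_n) : R :=
  Num.sqrt (\sum_(i < n) x 0 i ^+ 2).

Definition eball (R : realType) (n : nat) (x : 'rV[R]_n) (r : R) :
    set 'rV[R]_n :=
  [set y | enorm (y - x) < r].

(* C^k on an open set U: all derivatives involved depend only on the germ of f
   at points of U, so f is a total function whose values outside U are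
   irrelevant.  For f (Frechet) differentiable, the i-th row of the Jacobian
   matrix 'J f x is the partial derivative 'D_(delta_mx 0 i) f x; the successor
   clause thus says that Df exists on U and is of class C^k there. *)
Fixpoint Ck (R : realType) (n p k : nat) (U : set 'rV[R]_n)
    (f : 'rV[R]_n -> 'rV[R]_p) : Prop :=
  match k with
  | 0%N => forall x, U x -> {for x, continuous f}
  | k'.+1 => (forall x, U x -> differentiable f x) /\
             (forall i : 'I_n, Ck k' U ('D_(delta_mx 0 i) f))
  end.

Definition Coo (R : realType) (n p : nat) (U : set 'rV[R]_n)
    (f : 'rV[R]_n -> 'rV[R]_p) : Prop :=
  forall k : nat, Ck k U f.

(* Main.v *)
(* On the open dense set G where the rank of Df is locally constant, put
   A = Df(x0) and let C be a reflexive generalized inverse of A.  The map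
   Phi(y) = y + (f(y) - y A) C has derivative 1 at x0, so it is a bi-Lipschitz
   local homeomorphism (Banach's fixed point theorem); it satisfies
   Phi(y) A = f(y) C A.  Since the rank is constant, Df and Df C A have the same
   kernel, so f o Phi^-1 has zero derivative along the directions killed by A,
   and hence f = F o q o f near x0 with F = f o Phi^-1 Lipschitz and
   q(z) = x1 + (z - f(x0)) C affine of rank at most m.  Only Lipschitz maps are
   left to approximate: replacing F and the inner f by uniformly close polynomial
   maps (Bernstein) yields polynomial maps of rank at most m.
   Vectors are rows, so matrices act on the right. *)
From HB Require Import structures.
Require Import Defs.
From mathcomp Require Import all_boot all_order all_algebra.
From mathcomp Require Import all_classical all_reals all_analysis.
From mathcomp Require Import ring lra.
Set Implicit Arguments.
Unset Strict Implicit.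
Unset Printing Implicit Defensive.
Import Order.TTheory GRing.Theory Num.Theory.
Import numFieldNormedType.Exports.
Local Open Scope classical_set_scope.
Local Open Scope ring_scope.

(** * Polynomial functions and polynomial maps on row vectors *)

Inductive polyfun (R : realType) (n : nat) : ('rV[R]_n -> R) -> Prop :=
| polyfun_cst c : polyfun (fun=> c)
| polyfun_coord i : polyfun (fun x => x 0 i)
| polyfunD f g : polyfun f -> polyfun g -> polyfun (fun x => f x + g x)
| polyfunM f g : polyfun f -> polyfun g -> polyfun (fun x => f x * g x).

Definition polymap (R : realType) (n p : nat) (F : 'rV[R]_n -> 'rV[R]_p) :=
  forall j, polyfun (fun x => F x 0 j).

Section Polynomial.
Context {R : realType}.

Lemma polyfun_sum n p (F : 'I_p -> 'rV[R]_n -> R) :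
  (forall i, polyfun (F i)) -> polyfun (fun x => \sum_i F i x).
Proof.
move=> Fp; elim: p F Fp => [|p IH] F Fp.
  by under eq_fun do rewrite big_ord0; exact: polyfun_cst.
under eq_fun do rewrite big_ord_recl.
by apply: polyfunD => //; exact: IH.
Qed.

Lemma polyfun_comp n p (f : 'rV[R]_p -> R) (F : 'rV[R]_n -> 'rV[R]_p) :
  polyfun f -> polymap F -> polyfun (fun x => f (F x)).
Proof.
move=> + Fp; elim=> [c|i|g h _ IHg _ IHh|g h _ IHg _ IHh].
- exact: polyfun_cst.
- exact: Fp.
- exact: polyfunD.
- exact: polyfunM.
Qed.

Lemma polymap_comp n p q (G : 'rV[R]_p -> 'rV[R]_q) (F : 'rV[R]_n -> 'rV[R]_p) :
  polymap G -> polymap F -> polymap (fun x => G (F x)).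
Proof. by move=> Gp Fp j; exact: (@polyfun_comp _ _ (fun y => G y 0 j)). Qed.

Lemma polymap_affine n p (a : 'rV[R]_p) (b : 'rV[R]_n) (M : 'M[R]_(n, p)) :
  polymap (fun x => a + (x - b) *m M).
Proof.
move=> j; under eq_fun do rewrite !mxE.
apply/polyfunD/polyfun_sum => [|i]; first exact: polyfun_cst.
under eq_fun do rewrite !mxE.
apply/polyfunM/polyfun_cst/polyfunD/polyfun_cst.
exact: polyfun_coord.
Qed.

Lemma polyfun_differentiable n (f : 'rV[R]_n -> R) x :
  polyfun f -> differentiable f x.
Proof.
elim=> [c|i|g h _ IHg _ IHh|g h _ IHg _ IHh].
- exact: differentiable_cst.
- exact: differentiable_coord.
- exact: differentiableD.
- exact: differentiableM.
Qed.

Lemma polyfun_derive n (f : 'rV[R]_n -> R) v :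
  polyfun f -> polyfun ('D_v f).
Proof.
elim=> [c|i|g h gp IHg hp IHh|g h gp IHg hp IHh].
- rewrite (_ : 'D_v _ = fun=> 0); first exact: polyfun_cst.
  by apply/funext => x; rewrite derive_cst.
- rewrite (_ : 'D_v _ = fun=> v 0 i); first exact: polyfun_cst.
  apply/funext => x.
  have : 'D_v (@id 'rV[R]_n) x 0 i = v 0 i by rewrite derive_id.
  by rewrite derive_mx ?mxE//; exact: derivable_id.
- rewrite (_ : 'D_v _ = fun x => 'D_v g x + 'D_v h x); first exact: polyfunD.
  by apply/funext => x; rewrite deriveD//;
    apply/diff_derivable/polyfun_differentiable.
- rewrite (_ : 'D_v _ = fun x => g x * 'D_v h x + h x * 'D_v g x).
    by apply: polyfunD; exact: polyfunM.
  by apply/funext => x; rewrite deriveM//;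
    apply/diff_derivable/polyfun_differentiable.
Qed.

Lemma polymap_differentiable n p (F : 'rV[R]_n -> 'rV[R]_p) x :
  polymap F -> differentiable F x.
Proof.
move=> Fp; rewrite (_ : F = \sum_j (fun y => F y 0 j *: delta_mx 0 j)).
  apply: differentiable_sum => j.
  by apply: differentiableZl; exact: polyfun_differentiable.
by apply/funext => y; rewrite fct_sumE [LHS]row_sum_delta.
Qed.

(** Partial derivatives of polynomial maps are polynomial maps, so the induction on [k] never leaves
    the class. *)
Lemma polymap_Coo n p (F : 'rV[R]_n -> 'rV[R]_p) U : polymap F -> Coo U F.
Proof.
move=> + k; elim: k F => [|k IH] F Fp /=.
  by move=> x _; exact/differentiable_continuous/polymap_differentiable.
split=> [x _|i]; first exact: polymap_differentiable.
apply: IH => j; rewrite (_ : (fun _ => _) = 'D_(delta_mx 0 i) (fun y => F y 0 j)).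
  exact: polyfun_derive.
apply/funext => x; rewrite derive_mx ?mxE//.
exact/diff_derivable/polymap_differentiable.
Qed.

End Polynomial.

(** * Estimates in the sup norm of matrices *)

Section MatrixNorm.
Context {R : realType}.

Lemma mx_norm_le m n (A : 'M[R]_(m, n)) e :
  0 <= e -> (forall i j, `|A i j| <= e) -> `|A| <= e.
Proof.
by move=> e0 Ae; rewrite /Num.Def.normr/= mx_normrE; apply/bigmax_leP; split.
Qed.

Lemma mx_entry_le m n (A : 'M[R]_(m, n)) i j : `|A i j| <= `|A|.
Proof.
rewrite [leRHS]/Num.Def.normr/= mx_normrE.
exact: (le_bigmax _ (fun ij => `|A ij.1 ij.2|) (i, j)).
Qed.

(** The factor [n] counts the terms in each entry of the product. *)
Lemma mulmx_norm_le m n p (A : 'M[R]_(m, n)) (B : 'M[R]_(n, p)) :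
  `|A *m B| <= n%:R * `|A| * `|B|.
Proof.
apply: mx_norm_le => [|i j]; first by rewrite !mulr_ge0.
rewrite mxE (le_trans (ler_norm_sum _ _ _))//.
have -> : n%:R * `|A| * `|B| = \sum_(k < n) `|A| * `|B|.
  by rewrite sumr_const card_ord -mulrA mulr_natl.
by apply: ler_sum => k _; rewrite normrM ler_pM// mx_entry_le.
Qed.

End MatrixNorm.

(** * Bernstein approximation of Lipschitz functions on a cube *)

Section Bernstein.
Context {R : realType} {n : nat}.
Implicit Types (p a x : 'rV[R]_n) (h : R) (s : seq 'I_n) (f : 'rV[R]_n -> R).

(* Expectation of f at the end of a random walk started at a, which for each i
   in s moves by h along the i-th axis with probability p_i.  When each i occurs
   N times in s and p is affine in x, this is a Bernstein polynomial in x. *)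
Fixpoint walk p h s f a : R :=
  if s is i :: s' then
    (1 - p 0 i) * walk p h s' f a + p 0 i * walk p h s' f (a + h *: delta_mx 0 i)
  else f a.

Lemma walk_le p h s f g a : (forall i, 0 <= p 0 i <= 1) ->
  (forall y, f y <= g y) -> walk p h s f a <= walk p h s g a.
Proof.
move=> p01 fg; elim: s a => [|i s IH] a //=.
by case/andP: (p01 i) => p0 p1; rewrite lerD// ler_wpM2l// subr_ge0.
Qed.

(** Squared bias plus variance: with N the number of occurrences of [k] in [s], the [k]-th
    coordinate of the end point is binomial with mean [a_k + h N p_k] and variance
    [h^2 N p_k (1 - p_k)]. *)
Lemma walk_quadratic p h s a x c b :
  walk p h s (fun y => c + b * \sum_k (y 0 k - x 0 k) ^+ 2) a =
  c + b * \sum_k ((a 0 k + h * (count_mem k s)%:R * p 0 k - x 0 k) ^+ 2 +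
                  h ^+ 2 * (count_mem k s)%:R * (p 0 k * (1 - p 0 k))).
Proof.
elim: s a => [|i s IH] a /=.
  congr (_ + _ * _); apply: eq_bigr => k _.
  by rewrite !mulr0 !mul0r !addr0.
rewrite !IH.
set S0 := \sum_k _; set S1 := \sum_k _; set S := \sum_k _.
suff -> : S = (1 - p 0 i) * S0 + p 0 i * S1 by ring.
rewrite /S !mulr_sumr -big_split/=; apply: eq_bigr => k _.
rewrite !mxE eqxx/= natrD eq_sym.
have [->|ki] := eqVneq i k; rewrite /= ?mulr1n ?mulr0n; ring.
Qed.

Lemma polyfun_walk h s f a (P : 'rV[R]_n -> 'rV[R]_n) : polymap P ->
  polyfun (fun x => walk (P x) h s f a).
Proof.
move=> Pp; elim: s a => [|i s IH] a /=; first exact: polyfun_cst.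
apply: polyfunD; apply: polyfunM => //.
rewrite (_ : (fun _ => _) = fun x => 1 + -1 * P x 0 i); last first.
  by apply/funext => x; rewrite mulN1r.
by apply/polyfunD/polyfunM => //; exact: polyfun_cst.
Qed.

(** The distance [L * |y - x|] is dominated by a quadratic in [y]. Since [walk] is monotone, its
    error at [x] is at most its value on that quadratic, which [walk_quadratic] computes. The
    Lipschitz bound is global because [walk_le] compares functions at every point. *)
Lemma global_lipschitz_polyfun_approx f (c : 'rV[R]_n) (r L e : R) :
  0 < r -> 0 < e -> (forall x y, `|f x - f y| <= L * `|x - y|) ->
  exists2 P, polyfun P & forall x, `|x - c| <= r -> `|P x - f x| <= e.
Proof.
move=> r0 e0 fL.
(* Completing the square gives [L t <= e / 2 + K t^2] for this [K]. *)
pose K := L ^+ 2 / (2 * e); have K0 : 0 <= K.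
  by rewrite divr_ge0 ?sqr_ge0// mulr_ge0// ltW.
(* With [N] steps of length [2 r / N] along each axis, the variances sum to at most [n (2 r)^2 / N];
   this [N] makes [K] times that bound at most [e / 2]. *)
pose N := (Num.truncn (2 * (K * n%:R * (2 * r) ^+ 2) / e)).+1.
have N0 : 0 < N%:R :> R by rewrite ltr0n.
have NE : K * n%:R * (2 * r) ^+ 2 / N%:R <= e / 2.
  have := truncnS_gt (2 * (K * n%:R * (2 * r) ^+ 2) / e).
  rewrite -/N ltr_pdivrMr// ler_pdivrMr// => ?; lra.
(* The walk starts at the lowest corner of the cube, and [q] rescales the cube to [[0, 1]^n]. The
   mean end point is then [a + 2 r q(x) = x], so there is no bias. *)
pose a := c - const_mx r : 'rV[R]_n.
pose s := flatten (nseq N (enum 'I_n)).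
pose q x : 'rV[R]_n := 0 + (x - a) *m (2 * r)^-1%:M.
have qE x k : q x 0 k = (x 0 k - a 0 k) / (2 * r).
  by rewrite /q add0r mul_mx_scalar !mxE mulrC.
have sE k : count_mem k s = N.
  rewrite count_flatten map_nseq sumn_nseq count_uniq_mem ?enum_uniq//.
  by rewrite mem_enum mul1n.
exists (fun x => walk (q x) (2 * r / N%:R) s f a).
  exact/polyfun_walk/polymap_affine.
move=> x xc.
have q01 k : 0 <= q x 0 k <= 1.
  have /andP[h1 h2] : - r <= x 0 k - c 0 k <= r.
    rewrite -ler_norml; apply: le_trans xc.
    by have := mx_entry_le (x - c) 0 k; rewrite !mxE.
  rewrite qE /a !mxE; apply/andP; split.
    by apply: divr_ge0; lra.
  by rewrite ler_pdivrMr; lra.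
have fQ y : `|f y - f x| <= e / 2 + K * \sum_k (y 0 k - x 0 k) ^+ 2.
  apply: (le_trans (fL y x)).
  have /le_trans : L * `|y - x| <= e / 2 + K * `|y - x| ^+ 2.
    rewrite /K -subr_ge0.
    set t := `|y - x|.
    have -> : e / 2 + L ^+ 2 / (2 * e) * t ^+ 2 - L * t =
        (e - L * t) ^+ 2 / (2 * e) by field; rewrite gt_eqF.
    by rewrite divr_ge0 ?sqr_ge0// mulr_ge0// ltW.
  apply; rewrite lerD2l ler_wpM2l//.
  set S := \sum_k _; have S0 : 0 <= S by apply: sumr_ge0 => k _; exact: sqr_ge0.
  rewrite -(sqr_sqrtr S0) ler_pXn2r ?nnegrE ?sqrtr_ge0//.
  apply: mx_norm_le => [|i k]; first exact: sqrtr_ge0.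
  rewrite ord1 -sqrtr_sqr ler_wsqrtr// /S (bigD1 k)//= !mxE lerDl.
  by apply: sumr_ge0 => l _; exact: sqr_ge0.
(* The values 1 and -1 of [b] give the upper and the lower bound. *)
have WQ b : walk (q x) (2 * r / N%:R) s
    (fun y => (f x + b * (e / 2)) + b * K * \sum_k (y 0 k - x 0 k) ^+ 2) a =
    f x + b * (e / 2 + K * \sum_k (2 * r) ^+ 2 / N%:R * (q x 0 k * (1 - q x 0 k))).
  rewrite walk_quadratic; set S1 := \sum_k _; set S2 := \sum_k _.
  suff -> : S1 = S2 by ring.
  apply: eq_bigr => k _; rewrite sE [in X in X ^+ 2]qE.
  by field; rewrite (gt_eqF r0) (gt_eqF N0).
have Kq : K * \sum_k (2 * r) ^+ 2 / N%:R * (q x 0 k * (1 - q x 0 k)) <= e / 2.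
  apply: le_trans NE; rewrite -!(mulrA K) -(mulrA n%:R) ler_wpM2l//.
  have -> : n%:R * ((2 * r) ^+ 2 / N%:R) = \sum_(k < n) (2 * r) ^+ 2 / N%:R.
    by rewrite sumr_const card_ord mulr_natl.
  apply: ler_sum => k _.
  have /andP[q0 q1] := q01 k.
  rewrite ler_piMr ?divr_ge0 ?sqr_ge0//; nra.
rewrite ler_distl; apply/andP; split.
- apply: (@le_trans _ _ (f x + -1 * (e / 2 + K * \sum_k (2 * r) ^+ 2 / N%:R *
      (q x 0 k * (1 - q x 0 k))))); first lra.
  rewrite -WQ; apply: walk_le => // y.
  have := fQ y; rewrite ler_distl => /andP[]; lra.
- apply: (@le_trans _ _ (f x + 1 * (e / 2 + K * \sum_k (2 * r) ^+ 2 / N%:R *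
      (q x 0 k * (1 - q x 0 k))))); last lra.
  rewrite -WQ; apply: walk_le => // y.
  have := fQ y; rewrite ler_distl => /andP[]; lra.
Qed.

End Bernstein.

(** Clamping each coordinate is a 1-Lipschitz retraction onto the closed cube of radius [r];
    composing with it makes each coordinate of [F] globally Lipschitz without changing it on the
    cube. *)
Lemma lipschitz_polymap_approx (R : realType) n p (F : 'rV[R]_n -> 'rV[R]_p)
    (c : 'rV[R]_n) (r L e : R) : 0 < r -> 0 < e -> 0 <= L ->
  (forall x y, `|x - c| <= r -> `|y - c| <= r -> `|F x - F y| <= L * `|x - y|) ->
  exists2 P, polymap P & forall x, `|x - c| <= r -> `|P x - F x| <= e.
Proof.
move=> r0 e0 L0 FL.
pose clamp (x : 'rV[R]_n) : 'rV[R]_n :=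
  \row_k Num.max (c 0 k - r) (Num.min (c 0 k + r) (x 0 k)).
have clampr x : `|clamp x - c| <= r.
  apply: mx_norm_le => [|i k]; first exact: ltW.
  rewrite ord1 !mxE ler_norml; set m := Num.min _ _.
  have : m <= c 0 k + r by rewrite ge_min lexx.
  by case: (leP (c 0 k - r) m) => ? ?; apply/andP; split; lra.
have clampL x y : `|clamp x - clamp y| <= `|x - y|.
  apply: mx_norm_le => // i k; apply: le_trans (mx_entry_le _ 0 k).
  rewrite !mxE.
  set u := x 0 k; set v := y 0 k; set d := c 0 k.
  have := lexx `|u - v|; rewrite ler_norml => /andP[h1 h2].
  have dr : d - r <= d + r by lra.
  rewrite ler_norml; case: (leP (d + r) u) => ?; case: (leP (d + r) v) => ?;
    rewrite ?(max_idPr dr); case: (leP (d - r) u) => ?; case: (leP (d - r) v) => ?;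
    apply/andP; split; lra.
have clampE x : `|x - c| <= r -> clamp x = x.
  move=> xc; apply/rowP => k; rewrite mxE.
  have := le_trans (mx_entry_le _ 0 k) xc; rewrite !mxE ler_norml => /andP[? ?].
  by rewrite (min_idPr _) ?(max_idPr _)//; lra.
have /choice[P PP] : forall j : 'I_p, exists P : 'rV[R]_n -> R, polyfun P /\
    forall x, `|x - c| <= r -> `|P x - F x 0 j| <= e.
  move=> j.
  have [|P P1 P2] := @global_lipschitz_polyfun_approx R n
    (fun x => F (clamp x) 0 j) c r L e r0 e0.
    move=> x y; have := mx_entry_le (F (clamp x) - F (clamp y)) 0 j.
    rewrite !mxE => /le_trans; apply; apply: le_trans (FL _ _ _ _) _ => //.
    by rewrite ler_wpM2l.
  by exists P; split => // x xc; have := P2 x xc; rewrite clampE.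
exists (fun x => \row_j P j x).
  by move=> j; under eq_fun do rewrite mxE; have [] := PP j.
move=> x xc; apply: mx_norm_le => [|i j]; first exact: ltW.
by rewrite ord1 !mxE; have [_] := PP j; apply.
Qed.

(** * Rank under perturbation and multiplication *)

Section Rank.
Context {R : realType}.

(** Take [B] with [A B A = A]. For [A'] near [A], the matrix [N = 1 + (A' - A) B] is invertible and
    [A B N = A B A' B], so [rank A <= rank (A B) <= rank A']. *)
Lemma mxrank_lower_semicontinuous m n (A : 'M[R]_(m, n)) :
  exists2 d, 0 < d & forall A', `|A' - A| < d -> (\rank A <= \rank A')%N.
Proof.
have [B ABA] : exists B, A *m B *m A = A by exists (pinvmx A); rewrite mulmxKpV.
(* If [v N = 0], then [|v| <= |v| |A' - A| (k - 1)], which forces [v = 0] once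
   [|A' - A| < 1 / k]. *)
pose k := m%:R * (n%:R * `|B|) + 1.
have k0 : 0 < k by rewrite ltr_wpDl// !mulr_ge0.
exists k^-1 => [|A' A'A]; first by rewrite invr_gt0.
pose N := 1%:M + (A' - A) *m B.
have Nu : row_free N.
  rewrite -kermx_eq0; apply/rowV0P => v /sub_kermxP.
  rewrite mulmxDr mulmx1 => /eqP; rewrite addr_eq0 => /eqP vE.
  apply/eqP; rewrite -normr_le0 leNgt; apply/negP => v0.
  have : `|v| <= m%:R * `|v| * (n%:R * `|A' - A| * `|B|).
    rewrite [leLHS](_ : _ = `|v *m ((A' - A) *m B)|); last first.
      by rewrite {1}vE normrN.
    apply: (le_trans (mulmx_norm_le _ _)); rewrite ler_wpM2l ?mulr_ge0//.
    exact: mulmx_norm_le.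
  apply/negP; rewrite -ltNge.
  rewrite (_ : _ * _ = `|v| * (`|A' - A| * (k - 1))); last by rewrite /k; ring.
  rewrite gtr_pMr//; apply: (@le_lt_trans _ _ (k^-1 * (k - 1))).
    by rewrite ler_wpM2r ?(ltW A'A)// /k addrK !mulr_ge0.
  by rewrite mulrBr mulVf ?gt_eqF// ltrBlDr ltrDl mulr1 invr_gt0.
have E : A *m B *m N = A *m B *m A' *m B.
  by rewrite mulmxDr mulmx1 mulmxBl mulmxBr !mulmxA ABA addrC subrK.
apply: (@leq_trans (\rank (A *m B))); first by rewrite -[X in \rank X]ABA mxrankM_maxl.
rewrite -(mxrankMfree _ Nu) E -mulmxA.
by rewrite (leq_trans (mxrankM_maxr _ _))// mxrankM_maxl.
Qed.

(** The column space of [D X] lies in that of [D], and equal dimensions make them equal.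
    Transposition turns this into a statement on row spaces. *)
Lemma mxrank_mulmx_eq m n p (D : 'M[R]_(m, n)) (X : 'M[R]_(n, p)) :
  (\rank D <= \rank (D *m X))%N -> exists M, D = D *m X *m M.
Proof.
move=> rk; have : (D^T <= (D *m X)^T)%MS.
  have sub : ((D *m X)^T <= D^T)%MS by rewrite trmx_mul submxMl.
  by rewrite -(geq_leqif (mxrank_leqif_sup sub)) !mxrank_tr.
by case/submxP => M /(congr1 trmx); rewrite trmx_mul !trmxK; exists M^T.
Qed.

Lemma reflexive_pinvmx m n (A : 'M[R]_(m, n)) :
  exists C, [/\ A *m C *m A = A, C *m A *m C = C & (\rank C <= \rank A)%N].
Proof.
have [B ABA] : exists B, A *m B *m A = A by exists (pinvmx A); rewrite mulmxKpV.
exists (B *m A *m B); split.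
- by rewrite !mulmxA !ABA.
- have -> : B *m A *m B *m A *m (B *m A *m B) =
      B *m (A *m B *m A *m B *m A) *m B by rewrite !mulmxA.
  by rewrite !ABA.
- by rewrite (leq_trans (mxrankM_maxl _ _))// mxrankM_maxr.
Qed.

End Rank.

(** * Mean value inequality for vector-valued maps *)

Section MeanValue.
Context {R : realType} {n p : nat}.

Lemma segment_norm_le (c x y : 'rV[R]_n) r t : `|x - c| <= r -> `|y - c| <= r ->
  0 <= t <= 1 -> `|y + t *: (x - y) - c| <= r.
Proof.
move=> xc yc /andP[t0 t1].
have -> : y + t *: (x - y) - c = (1 - t) *: (y - c) + t *: (x - c).
  by apply/rowP => k; rewrite !mxE; ring.
apply: (le_trans (ler_normD _ _)); rewrite !normrZ !ger0_norm ?subr_ge0//.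
have -> : r = (1 - t) * r + t * r by ring.
by rewrite lerD// ler_wpM2l// subr_ge0.
Qed.

Implicit Type f : 'rV[R]_n -> 'rV[R]_p.

Lemma is_derive_line f (y v : 'rV[R]_n) t j : differentiable f (y + t *: v) ->
  is_derive t (1 : R) (fun s => f (y + s *: v) 0 j)
    ((v *m 'J f (y + t *: v)) 0 j).
Proof.
move=> df; pose l s := y + s *: v.
have dl : is_diff t l ( *:%R ^~ v).
  have : is_diff t (cst y + *:%R ^~ v) (0 + *:%R ^~ v) by exact: is_diffD.
  by rewrite add0r.
have dfl : differentiable (f \o l) t by exact: differentiable_comp.
have fl : derivable (f \o l) t 1 by exact: diff_derivable.
apply: DeriveDef; first exact: (derivable_mxP _ _ _).1.
have : 'D_1 (f \o l) t = v *m 'J f (l t).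
  by rewrite deriveE// diff_comp// diff_val/= scale1r /jacobian mul_rV_lin1.
by move/rowP => /(_ j); rewrite derive_mx// mxE.
Qed.

(** The scalar mean value theorem is applied to each entry of [f - A] along the segment. Each entry
    has its own intermediate point, which is harmless in the sup norm. *)
Lemma mean_value_ineq f (c : 'rV[R]_n) r A e :
  (forall y, `|y - c| <= r -> differentiable f y /\ `|'J f y - A| <= e) ->
  forall x y, `|x - c| <= r -> `|y - c| <= r ->
  `|f x - f y - (x - y) *m A| <= n%:R * e * `|x - y|.
Proof.
move=> fA x y xc yc.
have e0 : 0 <= e by have [_] := fA x xc; apply: le_trans.
apply: mx_norm_le => [|i j]; first by rewrite !mulr_ge0.
rewrite ord1 => {i}.
set v := x - y.
have seg t : 0 <= t <= 1 -> `|y + t *: v - c| <= r by exact: segment_norm_le.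
pose g := (fun s => f (y + s *: v) 0 j) - ( *:%R ^~ ((v *m A) 0 j)).
pose g' t := (v *m ('J f (y + t *: v) - A)) 0 j.
have gd (t : R) : 0 <= t <= 1 -> is_derive t (1 : R) g (g' t).
  move=> t01.
  have h1 := is_derive_line j (proj1 (fA _ (seg _ t01))).
  have h2 : is_derive t (1 : R) ( *:%R ^~ ((v *m A) 0 j)) ((v *m A) 0 j).
    apply: DeriveDef; first exact: diff_derivable.
    by rewrite deriveE// diff_val scale1r.
  apply: (is_derive_eq (is_deriveB h1 h2)).
  by rewrite /g' mulmxBr !mxE.
have [||t] := @MVT_segment R g g' 0 1 ler01.
- by move=> t; rewrite in_itv/= => /andP[t0 t1]; apply: gd; rewrite !ltW.
- apply: derivable_within_continuous => t; rewrite in_itv/= => t01.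
  by have := gd t t01.
- rewrite in_itv/= => t01; rewrite subr0 mulr1 => E.
  have -> : (f x - f y - v *m A) 0 j = g' t.
    by rewrite -E /g !fctE /= scale1r scale0r addr0 /v subrKC !mxE /GRing.scale/=; ring.
  rewrite (le_trans (mx_entry_le _ _ _))// (le_trans (mulmx_norm_le _ _))//.
  rewrite -!mulrA ler_wpM2l// mulrC ler_wpM2r//.
  by have [] := fA _ (seg _ t01).
Qed.

End MeanValue.

(** Joins completeness to the normed structure of matrices, for Banach's fixed point theorem. *)
HB.instance Definition _ (R : realType) m n := Complete.on 'M[R]_(m, n).

(** * Inverting the identity plus a contraction on a closed ball *)

Section PerturbedIdentity.
Context {R : realType} {n : nat} (psi : 'rV[R]_n -> 'rV[R]_n).
Context (x0 : 'rV[R]_n) (d : R).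
Context (psiL : forall x y, `|x - x0| <= d -> `|y - x0| <= d ->
  `|psi x - psi y| <= 2^-1 * `|x - y|).

Lemma perturbed_id_expand x y : `|x - x0| <= d -> `|y - x0| <= d ->
  `|x - y| <= 2 * `|(x + psi x) - (y + psi y)|.
Proof.
move=> xd yd; have := psiL xd yd.
have : `|x - y| <= `|(x + psi x) - (y + psi y)| + `|psi x - psi y|.
  have -> : `|x - y| = `|(x + psi x) - (y + psi y) - (psi x - psi y)|.
    by congr `|_|; apply/rowP => k; rewrite !mxE; ring.
  exact: ler_normB.
lra.
Qed.

(** The solution is the fixed point of [T y = u - psi y], which maps the closed ball of radius [d]
    into itself: the shift of [u] and the variation of [psi] each contribute at most [d / 2]. *)
Lemma perturbed_id_surj u : 0 <= d -> `|u - (x0 + psi x0)| <= d / 2 ->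
  exists2 y, `|y - x0| <= d & y + psi y = u.
Proof.
move=> d0 ud.
pose U : set 'rV[R]_n := closed_ball_ Num.norm x0 d.
have UE y : U y = (`|y - x0| <= d) by rewrite /U/= distrC.
pose T y := u - psi y.
have TU : set_fun U U T.
  move=> y /=; rewrite !UE => yU.
  have -> : T y - x0 = (u - (x0 + psi x0)) + (psi x0 - psi y).
    by apply/rowP => k; rewrite /T !mxE; ring.
  apply: (le_trans (ler_normD _ _)).
  have x0U : `|x0 - x0| <= d by rewrite subrr normr0.
  have := psiL x0U yU; rewrite distrC (distrC x0); lra.
pose f : {fun U >-> U} := HB.pack T (isFun.Build _ _ _ _ _ TU).
have [|||y yU yE] := @banach_fixed_point R 'rV[R]_n U f.
- exists 2^-1%:nng; split => /=; first lra.
  move=> [x y] [/= xU yU].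
  have -> : T x - T y = psi y - psi x.
    by apply/rowP => k; rewrite /T !mxE; ring.
  by rewrite distrC psiL// -UE.
- exact: closed_closed_ball_.
- by exists x0; rewrite UE subrr normr0.
- by exists y; [rewrite -UE|rewrite {1}yE /= /T subrK].
Qed.

End PerturbedIdentity.

(** Differentiability is a conclusion here: the lemma serves for a function known only through
    bounds on its increments. *)
Lemma is_derive_line_eq0 (R : realType) (phi : R -> R) t :
  (forall e, 0 < e -> \forall h \near 0, `|phi (t + h) - phi t| <= e * `|h|) ->
  is_derive t (1 : R) phi 0.
Proof.
move=> H; have : (fun h => h^-1 *: ((phi \o shift t) (h *: (1 : R)) - phi t)) @ 0^'
    --> (0 : R).
  apply/cvgrPdist_le => e e0; near=> h.
  have h0 : h != 0 by near: h; exact: nbhs_dnbhs_neq.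
  rewrite sub0r normrN /= normrM normfV ler_pdivrMl ?normr_gt0//.
  rewrite mulrC [_ *: _]mulr1 (addrC h); near: h.
  by apply: nbhs_dnbhs; exact: H.
move=> H1; apply: DeriveDef; first by apply/cvg_ex; exists 0.
exact: cvg_lim H1.
Unshelve. all: by end_near. Qed.

Lemma differentiable_near (R : realType) n p (f : 'rV[R]_n -> 'rV[R]_p) x e :
  differentiable f x -> 0 < e ->
  exists2 d, 0 < d & forall y, `|y - x| < d ->
    `|f y - f x - (y - x) *m 'J f x| <= e * `|y - x|.
Proof.
move=> /diff_locally /eqaddoP fx e0.
have /nbhs_norm0P[d /= d0 fd] := fx e e0.
exists d => // y yx; have := fd (y - x) yx.
by rewrite /= !fctE/= subrK /jacobian mul_rV_lin1/= opprD addrA.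
Qed.

(** Meant for an increment [a] of [f] over a displacement [w], with [D] the derivative. If [a] is
    killed by [C A], the linear part [w D] is recovered from the remainder [a - w D], so the whole
    increment is as small as the remainder. *)
Lemma residual_mulmx (R : realType) m n p (a : 'M[R]_(m, p)) (w : 'M[R]_(m, n))
    (D : 'M[R]_(n, p)) (C : 'M[R]_(p, n)) (A : 'M[R]_(n, p)) (M : 'M[R]_p) :
  a *m C *m A = 0 -> D = D *m (C *m A) *m M ->
  (a - w *m D) *m (C *m A *m M) = - (w *m D).
Proof.
move=> aCA DE; rewrite mulmxBl !mulmxA aCA mul0mx sub0r.
by rewrite [in RHS]DE !mulmxA.
Qed.

(** * Local factorization at a point of constant rank *)

Section ConstantRank.
Context {R : realType} {n p : nat} (f : 'rV[R]_n -> 'rV[R]_p) (x0 : 'rV[R]_n).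
Let A := 'J f x0.

(** The bound [r / 2] on the affine argument, against the radius [r] on which [F] is Lipschitz,
    leaves room to perturb the inner [f]. *)
Lemma constant_rank_factor (d0 : R) : 0 < d0 ->
  (forall y, `|y - x0| <= d0 ->
     differentiable f y /\ (\rank ('J f y) <= \rank ('J f x0))%N) ->
  (forall e, 0 < e ->
     exists2 d, 0 < d & forall y, `|y - x0| <= d -> `|'J f y - 'J f x0| <= e) ->
  exists (C : 'M[R]_(p, n)) (F : 'rV[R]_n -> 'rV[R]_p) (x1 : 'rV[R]_n)
    (r eta L : R),
  [/\ (\rank C <= \rank ('J f x0))%N, [/\ 0 < r, 0 < eta & 0 <= L],
      forall x y, `|x - x0| <= eta -> `|y - x0| <= eta ->
        `|f x - f y| <= L * `|x - y|,
      forall u v, `|u - x1| <= r -> `|v - x1| <= r ->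
        `|F u - F v| <= L * `|u - v| &
      forall y, `|y - x0| <= eta ->
        `|(f y - f x0) *m C| <= r / 2 /\ f y = F (x1 + (f y - f x0) *m C)].
Proof.
move=> d0_gt0 fd0 Jc.
have [C [ACA CAC rC]] := reflexive_pinvmx A.
have [d2 d2_gt0 lsc] := mxrank_lower_semicontinuous A.
(* The first term makes [psi] Lipschitz with constant 1/2; the second puts ['J f y *m (C *m A)]
   within [d2] of [A = A C A], so that its rank is at least that of [A]. *)
pose e := Num.min (2 * (p%:R * n%:R * `|C| + 1))^-1 (d2 / (p%:R * `|C *m A| + 1)).
have e_gt0 : 0 < e.
  by rewrite lt_min invr_gt0 divr_gt0 ?mulr_gt0// ltr_wpDl// ?mulr_ge0// mulr_ge0.
have [d3 d3_gt0 Jd3] := Jc e e_gt0.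
pose d := Num.min d0 d3.
have d_gt0 : 0 < d by rewrite lt_min d0_gt0.
have fd y : `|y - x0| <= d -> differentiable f y /\ `|'J f y - A| <= e.
  by rewrite le_min => /andP[yd0 yd3]; split; [have [] := fd0 y yd0|exact: Jd3].
have fM y : `|y - x0| <= d -> exists M, 'J f y = 'J f y *m (C *m A) *m M.
  move=> yd; apply: mxrank_mulmx_eq.
  have yd0 : `|y - x0| <= d0 by move: yd; rewrite le_min => /andP[].
  have [_ /leq_trans->//] := fd0 y yd0.
  apply: lsc; rewrite -{2}ACA -(mulmxA A) -mulmxBl.
  apply: (le_lt_trans (mulmx_norm_le _ _)).
  apply: (@le_lt_trans _ _ (p%:R * `|C *m A| * (d2 / (p%:R * `|C *m A| + 1)))).
    rewrite mulrAC ler_wpM2l ?mulr_ge0//.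
    by have [_ /le_trans->//] := fd y yd; rewrite ge_min lexx orbT.
  rewrite mulrA ltr_pdivrMr ?ltr_wpDl ?mulr_ge0// mulrC ltr_pM2l//.
  by rewrite ltrDl.
have mv := mean_value_ineq fd.
pose psi y := (f y - y *m A) *m C.
have psiL x y : `|x - x0| <= d -> `|y - x0| <= d ->
    `|psi x - psi y| <= 2^-1 * `|x - y|.
  move=> xd yd; rewrite /psi -mulmxBl.
  have -> : f x - x *m A - (f y - y *m A) = f x - f y - (x - y) *m A.
    by rewrite mulmxBl; apply/rowP => k; rewrite !mxE; ring.
  apply: (le_trans (mulmx_norm_le _ _)).
  apply: (@le_trans _ _ (p%:R * (n%:R * e * `|x - y|) * `|C|)).
    by rewrite ler_wpM2r// ler_wpM2l// mv.
  rewrite (_ : _ * `|C| = (p%:R * n%:R * `|C|) * e * `|x - y|); last by ring.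
  rewrite ler_wpM2r//.
  apply: (@le_trans _ _ (p%:R * n%:R * `|C| * (2 * (p%:R * n%:R * `|C| + 1))^-1)).
    by rewrite ler_wpM2l ?mulr_ge0// ge_min lexx.
  have : 0 <= p%:R * n%:R * `|C| by rewrite !mulr_ge0.
  by move: (p%:R * n%:R * `|C|) => z z0; rewrite ler_pdivrMr; lra.
pose Lf := n%:R * e + n%:R * `|A|.
have Lf0 : 0 <= Lf by rewrite addr_ge0// mulr_ge0// ltW.
have fL x y : `|x - x0| <= d -> `|y - x0| <= d -> `|f x - f y| <= Lf * `|x - y|.
  move=> xd yd; rewrite -(subrK ((x - y) *m A) (f x - f y)) mulrDl.
  apply: (le_trans (ler_normD _ _)); rewrite lerD ?mv//.
  by apply: (le_trans (mulmx_norm_le _ _)); rewrite mulrAC.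
pose Phi y := y + psi y; pose x1 := Phi x0.
have PhiA y : Phi y *m A = f y *m C *m A.
  rewrite /Phi /psi mulmxDl !mulmxBl -!(mulmxA y) ACA.
  by rewrite addrC subrK.
have expand := perturbed_id_expand psiL.
(* [g] is the local inverse of [Phi]; its values off the ball of radius [d / 2] are arbitrary. *)
have /choice[g gE] : forall u, exists y, `|u - x1| <= d / 2 ->
    `|y - x0| <= d /\ Phi y = u.
  move=> u; have [ud|/negP ud] := boolP (`|u - x1| <= d / 2); last by exists x0.
  by have [y yd yu] := perturbed_id_surj psiL (ltW d_gt0) ud; exists y.
have gL u v : `|u - x1| <= d / 2 -> `|v - x1| <= d / 2 ->
    `|g u - g v| <= 2 * `|u - v|.
  move=> /gE[ud uE] /gE[vd vE]; rewrite -[in leRHS]uE -[in leRHS]vE.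
  exact: expand.
(* Half the radius available to [g], so that points slightly beyond a segment in the [r]-ball still
   lie in its domain. *)
pose r := d / 4.
have r_gt0 : 0 < r by rewrite divr_gt0.
have rd u : `|u - x1| <= r -> `|u - x1| <= d / 2.
  by move=> /le_trans->//; rewrite /r; lra.
(* [f \o g] is constant on segments directed by the kernel of [A]. As [g] is only known to be
   Lipschitz, the zero derivative is obtained from increments, through [residual_mulmx]. *)
have fibre u v : `|u - x1| <= r -> `|v - x1| <= r -> u *m A = v *m A ->
    f (g u) = f (g v).
  move=> ur vr uvA.
  pose w := v - u.
  have wA : w *m A = 0 by rewrite mulmxBl uvA subrr.
  have seg t : 0 <= t <= 1 -> `|u + t *: w - x1| <= r by exact: segment_norm_le.
  apply/rowP => j.
  pose phi t := f (g (u + t *: w)) 0 j.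
  have phi' (t : R) : 0 <= t <= 1 -> is_derive t (1 : R) phi 0.
    move=> /seg utr; apply: is_derive_line_eq0 => e' e'_gt0.
    have [yd yE] := gE _ (rd _ utr).
    set y := g _ in yd yE.
    have [dfy _] := fd y yd.
    have [M ME] := fM y yd.
    (* The first factor bounds [rho - rho C A M] by [|rho|], the second bounds [|y' - y|] by [|h|].
       Adding 1 to [|w|] keeps [K] positive when [w = 0]. *)
    pose K := (1 + p%:R * `|C *m A *m M|) * (2 * (`|w| + 1)).
    have w1_gt0 : 0 < `|w| + 1 by rewrite ltr_wpDl.
    have K_gt0 : 0 < K by rewrite mulr_gt0 ?mulr_gt0// ltr_wpDr// mulr_ge0.
    have [del del_gt0 fdel] := differentiable_near dfy (divr_gt0 e'_gt0 K_gt0).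
    have s_gt0 : 0 < Num.min del r / (2 * (`|w| + 1)).
      by rewrite divr_gt0 ?lt_min ?del_gt0 ?mulr_gt0.
    apply: filterS (nbhs0_lt s_gt0) => h.
    rewrite ltr_pdivlMr ?mulr_gt0// => hs.
    have hw : 2 * `|h *: w| <= `|h| * (2 * (`|w| + 1)).
      by rewrite normrZ mulrCA; rewrite !ler_wpM2l// lerDl.
    have [hdel hr] : 2 * `|h *: w| < del /\ 2 * `|h *: w| < r.
      by move: (le_lt_trans hw hs); rewrite lt_min => /andP.
    have uE : u + (t + h) *: w = (u + t *: w) + h *: w by rewrite scalerDl addrA.
    have utd : `|u + (t + h) *: w - x1| <= d / 2.
      rewrite uE addrAC (le_trans (ler_normD _ _))//.
      have := normr_ge0 (h *: w); move: hr utr; rewrite /r; lra.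
    rewrite /phi -/y; set y' := g _.
    have [y'd y'E] := gE _ utd.
    have yy' : `|y' - y| <= 2 * `|h *: w|.
      by rewrite (le_trans (gL _ _ utd (rd _ utr)))// uE addrAC subrr add0r.
    pose rho := f y' - f y - (y' - y) *m 'J f y.
    have rhoE : f y' - f y = rho - rho *m (C *m A *m M).
      have CA0 : (f y' - f y) *m C *m A = 0.
        rewrite !mulmxBl -!PhiA y'E yE -mulmxBl uE addrAC subrr add0r.
        by rewrite -scalemxAl wA scaler0.
      have -> : rho *m (C *m A *m M) = - ((y' - y) *m 'J f y).
        exact: residual_mulmx.
      by rewrite opprK /rho subrK.
    have -> : f y' 0 j - f y 0 j = (f y' - f y) 0 j by rewrite !mxE.
    rewrite (le_trans (mx_entry_le _ _ _))// rhoE (le_trans (ler_normB _ _))//.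
    apply: (@le_trans _ _ ((1 + p%:R * `|C *m A *m M|) * `|rho|)).
      rewrite mulrDl mul1r lerD2l (le_trans (mulmx_norm_le _ _))//.
      by rewrite mulrAC.
    have rho_le : `|rho| <= e' / K * (2 * `|h *: w|).
      apply: (le_trans (fdel y' (le_lt_trans yy' hdel))).
      by rewrite ler_wpM2l// divr_ge0 ?ltW.
    apply: (@le_trans _ _ ((1 + p%:R * `|C *m A *m M|) *
        (e' / K * (`|h| * (2 * (`|w| + 1)))))).
      rewrite ler_wpM2l ?addr_ge0 ?mulr_ge0//.
      by rewrite (le_trans rho_le)// ler_wpM2l// divr_ge0 ?ltW.
    rewrite [leLHS](_ : _ = e' / K * K * `|h|); last first.
      by move: (e' / K) => q; rewrite /K; ring.
    by rewrite divfK ?gt_eqF.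
  have [||t _] := @MVT_segment R phi (fun=> 0) 0 1 ler01.
  - by move=> t; rewrite in_itv/= => /andP[t0 t1]; apply: phi'; rewrite !ltW.
  - apply: derivable_within_continuous => t; rewrite in_itv/= => t01.
    by have := phi' t t01.
  - rewrite mul0r => /eqP; rewrite subr_eq0 => /eqP.
    by rewrite /phi scale1r scale0r addr0 /w subrKC.
(* With [eta * D = r / 2], the Lipschitz bound puts [(f y - f x0) C] within [r / 2], and [D >= 1]
   gives [2 * eta <= r], which keeps [Phi y] in the [r]-ball. *)
pose D := 1 + p%:R * Lf * `|C|.
have LC0 : 0 <= p%:R * Lf * `|C| by rewrite !mulr_ge0.
have D_gt0 : 0 < D by rewrite ltr_wpDr.
pose eta := r / (2 * D).
have eta_gt0 : 0 < eta by rewrite divr_gt0// mulr_gt0.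
have etaD : eta * D = r / 2 by rewrite /eta; field; rewrite gt_eqF.
have eta_r : 2 * eta <= r.
  by have := mulr_ge0 (ltW eta_gt0) LC0; move: etaD; rewrite /D; lra.
have etad y : `|y - x0| <= eta -> `|y - x0| <= d.
  by move: eta_r; rewrite /r; lra.
have x0d : `|x0 - x0| <= d by rewrite subrr normr0 ltW.
exists C, (f \o g), x1, r, eta, (2 * Lf); split => //.
- by split => //; rewrite mulr_ge0.
- move=> x y /etad xd /etad yd; apply: (le_trans (fL _ _ xd yd)).
  by rewrite ler_wpM2r// ler_peMl// ler1n.
- move=> u v /rd ud /rd vd /=; have [gud _] := gE u ud; have [gvd _] := gE v vd.
  apply: (le_trans (fL _ _ gud gvd)).
  by rewrite (mulrC 2) -mulrA ler_wpM2l// gL.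
- move=> y yeta; have yd := etad y yeta.
  have fC : `|(f y - f x0) *m C| <= r / 2.
    apply: (le_trans (mulmx_norm_le _ _)).
    apply: (@le_trans _ _ (eta * (p%:R * Lf * `|C|))).
      rewrite mulrA ler_wpM2r// mulrCA ler_wpM2l// (le_trans (fL _ _ yd x0d))//.
      by rewrite mulrC ler_wpM2r.
    by rewrite -etaD /D ler_wpM2l ?(ltW eta_gt0)// lerDr.
  split => //=.
  have Pyr : `|Phi y - x1| <= r.
    apply: le_trans eta_r.
    have -> : Phi y - x1 = (y - x0) + (psi y - psi x0).
      by rewrite /x1 /Phi; apply/rowP => k; rewrite !mxE; ring.
    apply: (le_trans (ler_normD _ _)).
    have := psiL _ _ yd x0d; move: yeta; have := normr_ge0 (y - x0); lra.
  have pyr : `|x1 + (f y - f x0) *m C - x1| <= r.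
    rewrite addrAC subrr add0r (le_trans fC)// ler_pdivrMr//.
    by rewrite ler_peMr ?ltW// ltr1n.
  have gy : g (Phi y) = y.
    have [gd PgE] := gE _ (rd _ Pyr).
    have := expand _ _ gd yd; rewrite -/(Phi (g _)) -/(Phi y) PgE subrr normr0 mulr0.
    by rewrite normr_le0 subr_eq0 => /eqP.
  (* By [PhiA], both [Phi y] and [x1 + (f y - f x0) C] are sent by [A] to [f y C A]. *)
  rewrite -{1}gy; apply: fibre => //.
  rewrite [RHS]mulmxDl (mulmxBl (f y)) [X in _ + X]mulmxBl -!PhiA.
  by rewrite [RHS]addrC subrK.
Qed.

End ConstantRank.

Lemma jacobian_comp (R : realType) n p q (f : 'rV[R]_n -> 'rV[R]_p)
    (g : 'rV[R]_p -> 'rV[R]_q) x :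
  differentiable f x -> differentiable g (f x) ->
  'J (g \o f) x = 'J f x *m 'J g (f x).
Proof.
move=> df dg; apply/row_matrixP => i; rewrite !rowE mulmxA /jacobian.
by rewrite !mul_rV_lin1 diff_comp.
Qed.

(** * Polynomial approximation near a point of constant rank *)

Section Approximation.
Context {R : realType} {n p : nat}.
Implicit Type f : 'rV[R]_n -> 'rV[R]_p.

Lemma constant_rank_approx f (x0 : 'rV[R]_n) (d0 : R) : 0 < d0 ->
  (forall y, `|y - x0| <= d0 ->
     differentiable f y /\ (\rank ('J f y) <= \rank ('J f x0))%N) ->
  (forall e, 0 < e ->
     exists2 d, 0 < d & forall y, `|y - x0| <= d -> `|'J f y - 'J f x0| <= e) ->
  exists2 eta, 0 < eta & forall e, 0 < e ->
    exists P : 'rV[R]_n -> 'rV[R]_p,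
      [/\ polymap P, forall y, (\rank ('J P y) <= \rank ('J f x0))%N &
          forall y, `|y - x0| <= eta -> `|P y - f y| <= e].
Proof.
move=> d0_gt0 fd0 Jc.
have [C [F [x1 [r [eta [L [rC [r0 eta0 L0] fL FL fF]]]]]]] :=
  constant_rank_factor d0_gt0 fd0 Jc.
exists eta => // e e0.
pose K := p%:R * `|C|; have K0 : 0 <= K by rewrite mulr_ge0.
(* The first term keeps the error of the inner approximation, after passing through [C] and [F],
   below [e / 2]; the second keeps the perturbed argument of [F] in the [r]-ball. *)
pose e1 := Num.min (e / (2 * (L * K + 1))) (r / (2 * (K + 1))).
have LK0 : 0 <= L * K by rewrite mulr_ge0.
have LK1 : 0 < L * K + 1 by rewrite ltr_wpDl.
have K1 : 0 < K + 1 by rewrite ltr_wpDl.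
have e1_gt0 : 0 < e1 by rewrite lt_min !divr_gt0// mulr_gt0.
have Ke1 : K * e1 <= r / 2.
  apply: (@le_trans _ _ (K * (r / (2 * (K + 1))))).
    by rewrite ler_wpM2l// ge_min lexx orbT.
  rewrite mulrA ler_pdivrMr ?mulr_gt0//; nra.
have LKe1 : L * (K * e1) <= e / 2.
  rewrite mulrA; apply: (@le_trans _ _ (L * K * (e / (2 * (L * K + 1))))).
    by rewrite ler_wpM2l// ge_min lexx.
  rewrite mulrA ler_pdivrMr ?mulr_gt0//; nra.
have [Pf Pfp Pff] := lipschitz_polymap_approx eta0 e1_gt0 L0 fL.
have e20 : 0 < e / 2 by rewrite divr_gt0.
have [PF PFp PFF] := lipschitz_polymap_approx r0 e20 L0 FL.
(* Splitting [C] into [col_base] and [row_base] makes the composite pass through a space of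
   dimension [\rank C], which bounds the rank of its Jacobian at every point. *)
pose g1 y := 0 + (Pf y - f x0) *m col_base C.
pose g2 z := PF (x1 + (z - 0) *m row_base C).
have g1p : polymap g1 by exact: polymap_comp (polymap_affine _ _ _) Pfp.
have g2p : polymap g2 by exact: polymap_comp PFp (polymap_affine _ _ _).
have gE y : g2 (g1 y) = PF (x1 + (Pf y - f x0) *m C).
  by rewrite /g2 /g1 add0r subr0 -mulmxA mulmx_base.
exists (g2 \o g1); split.
- exact: polymap_comp.
- move=> y; rewrite jacobian_comp; try exact: polymap_differentiable.
  by rewrite (leq_trans _ rC)// (leq_trans (mxrankM_maxl _ _))// rank_leq_col.
- move=> y ye; have [fC {1}->] := fF y ye; rewrite /= gE.
  have PfC : `|(Pf y - f y) *m C| <= K * e1.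
    rewrite (le_trans (mulmx_norm_le _ _))// /K mulrAC.
    by rewrite ler_wpM2l ?mulr_ge0// Pff.
  set u := x1 + (Pf y - f x0) *m C; set v := x1 + (f y - f x0) *m C.
  have uv : u - v = (Pf y - f y) *m C.
    by rewrite /u /v opprD addrACA subrr add0r -mulmxBl opprB addrA subrK.
  have vr : `|v - x1| <= r / 2 by rewrite /v addrAC subrr add0r.
  have ur : `|u - x1| <= r.
    rewrite -(subrKA v) uv (le_trans (ler_normD _ _))//.
    by move: PfC vr Ke1; lra.
  have {}vr : `|v - x1| <= r by move: vr r0; lra.
  rewrite -(subrKA (F u)) (le_trans (ler_normD _ _))//.
  have := PFF u ur; have := FL _ _ ur vr; rewrite uv => h1 h2.
  have : L * `|(Pf y - f y) *m C| <= L * (K * e1) by rewrite ler_wpM2l.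
  lra.
Qed.

Lemma Ck1_jacobian_near f U x e : open U -> Ck 1 U f -> U x -> 0 < e ->
  exists2 d, 0 < d & forall y, `|y - x| <= d -> U y /\ `|'J f y - 'J f x| <= e.
Proof.
move=> oU [df /= cf] Ux e0.
have H : \forall y \near x, U y /\ forall i : 'I_n,
    `|'D_(delta_mx 0 i) f x - 'D_(delta_mx 0 i) f y| <= e.
  near=> y; split; first by near: y; exact: open_nbhs_nbhs.
  near: y; apply: filter_forall => i.
  by have /cvgrPdist_le/(_ e e0) := cf i x Ux.
have /nbhs_normP[d /= d0 Hd] := H.
exists (d / 2) => [|y yx]; first by rewrite divr_gt0.
have [|Uy yD] := Hd y; first by rewrite /= distrC; lra.
split => //.
apply: mx_norm_le => [|i j]; first exact: ltW.
apply: le_trans (yD i); rewrite distrC.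
rewrite !deriveEjacobian; try exact: df.
by rewrite -mulmxBr -rowE; apply: le_trans (mx_entry_le _ 0 j); rewrite !mxE.
Unshelve. all: by end_near. Qed.

End Approximation.

(** * Euclidean balls, uniform convergence and the set of locally constant rank *)

Lemma mx_norm_le_enorm (R : realType) n (x : 'rV[R]_n) : `|x| <= enorm x.
Proof.
apply: mx_norm_le => [|i j]; first exact: sqrtr_ge0.
rewrite ord1 -sqrtr_sqr ler_wsqrtr// (bigD1 j)//= lerDl.
by apply: sumr_ge0 => k _; exact: sqr_ge0.
Qed.

Lemma norm_cvg_uniform (R : realType) n p (U : set 'rV[R]_n)
    (f_ : nat -> 'rV[R]_n -> 'rV[R]_p) (f : 'rV[R]_n -> 'rV[R]_p) :
  (forall i y, U y -> `|f_ i y - f y| <= i.+1%:R^-1) ->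
  {uniform U, f_ @ \oo --> f}.
Proof.
move=> H W /uniform_nbhs[E [entE EW]].
have [e /= e0 eE] : exists2 e : R, 0 < e &
    forall a b : 'rV[R]_p, `|a - b| < e -> E (a, b).
  move: entE; rewrite -entourage_ballE => -[e /= e0 eE].
  by exists e => // a b ab; apply: eE; rewrite /= -ball_normE.
rewrite /= nbhs_filterE; near=> i; apply: EW => y Uy.
apply: eE; rewrite distrC (le_lt_trans (H i y Uy))//.
by near: i; exact: near_infty_natSinv_lt (PosNum e0).
Unshelve. all: by end_near. Qed.

Theorem theorem3 (R : realType) (m n : nat) (hmn : (1 <= m < n)%N)
    (Omega : set 'rV[R]_n) (hOmega : open Omega)
    (f : 'rV[R]_n -> 'rV[R]_n) (hf : Ck 1 Omega f)
    (hrank : forall x, Omega x -> (\rank ('J f x) <= m)%N) :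
  exists G : set 'rV[R]_n,
    [/\ G `<=` Omega, open G, Omega `<=` closure G &
      forall x, G x ->
        exists (eps : R) (f_ : nat -> 'rV[R]_n -> 'rV[R]_n),
          [/\ 0 < eps,
              eball x eps `<=` G,
              forall i, Coo (eball x eps) (f_ i),
              forall i y, eball x eps y -> (\rank ('J (f_ i) y) <= m)%N &
              {uniform eball x eps, f_ @ \oo --> f}]].
Proof.
have Jn x e := @Ck1_jacobian_near R n n f Omega x e hOmega hf.
(* rk is opaque because comparing two terms \rank ('J f _) unfolds 'J. *)
have [rk rkE] : {rk : 'rV[R]_n -> nat | forall y, rk y = \rank ('J f y)}.
  by exists (fun y => \rank ('J f y)).
pose G := [set x | exists2 d : R, 0 < d & forall y, `|y - x| <= d ->
  Omega y /\ rk y = rk x].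
have GO : G `<=` Omega.
  by move=> x [d d0 /(_ x)[]//]; rewrite subrr normr0 ltW.
have Gn x d : 0 < d -> (forall y, `|y - x| <= d ->
    Omega y /\ rk y = rk x) ->
    forall y, `|y - x| <= d / 2 -> G y.
  move=> d0 xd y yx; exists (d / 2) => [|z zy]; first by rewrite divr_gt0.
  have yd : `|y - x| <= d by lra.
  have zd : `|z - x| <= d.
    by rewrite -(subrKA y) (le_trans (ler_normD _ _))//; lra.
  have [Oz zE] := xd z zd; have [_ yE] := xd y yd.
  by split; [exact: Oz|by rewrite zE yE].
have Go : open G.
  rewrite openE => x [d d0 xd]; apply: (nbhs_normP x G).2.
  exists (d / 2); first by rewrite /= divr_gt0.
  by move=> y /= yd; apply: (Gn x d d0 xd); rewrite distrC ltW.
exists G; split => //.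
- move=> x Ox B Bx.
  have /nbhs_normP[d /= d0 dB] : nbhs x (B `&` Omega).
    by apply: filterI => //; exact: open_nbhs_nbhs.
  (* Density: take a point [y] of the ball where the rank is largest. Near [y] the rank cannot drop,
     by lower semicontinuity, nor rise, by maximality. *)
  pose Q k := `[< exists y, `|y - x| < d /\ rk y = k >].
  have exQ : exists k, Q k.
    by exists (rk x); apply/asboolP; exists x; rewrite subrr normr0.
  have Qn k : Q k -> (k <= n)%N.
    by move=> /asboolP[y [_ <-]]; rewrite rkE; exact: rank_leq_row.
  have [k /asboolP[y [yx yk]] kmax] := ex_maxnP exQ Qn.
  have [By Oy] : B y /\ Omega y by apply: dB; rewrite /= distrC.
  exists y; split => //.
  have [d1 d1_gt0 lsc] := mxrank_lower_semicontinuous ('J f y).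
  have d12 : 0 < d1 / 2 by rewrite divr_gt0.
  have [d2 d2_gt0 yd2] := Jn y (d1 / 2) Oy d12.
  (* [d2] serves semicontinuity; the other term keeps [z] in the [d]-ball about [x], where the
     maximum was taken. *)
  pose d3 := Num.min d2 ((d - `|y - x|) / 2).
  have d3_gt0 : 0 < d3 by rewrite lt_min d2_gt0 divr_gt0// subr_gt0.
  exists d3 => // z; rewrite le_min => /andP[zd2 zd].
  have [Oz zJ] := yd2 z zd2; split; first exact: Oz.
  apply/eqP; rewrite eqn_leq yk; apply/andP; split.
    apply: kmax; apply/asboolP; exists z; split => //.
    by rewrite -(subrKA y) (le_lt_trans (ler_normD _ _))//; lra.
  by rewrite -yk !rkE lsc// (le_lt_trans zJ)//; lra.
- move=> x Gx; have Ox := GO x Gx; have [d d0 xd] := Gx.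
  have [||eta eta0 approx] := @constant_rank_approx R n n f x d d0.
  - move=> y yd; have [Oy yE] := xd y yd; have [df _] := hf.
    split; first exact: df.
    exact (eq_leq (etrans (esym (rkE y)) (etrans yE (rkE x)))).
  - move=> e e0; have [d1 d10 H] := Jn x e Ox e0.
    by exists d1 => // y /H[].
  have /choice[f_ fE] : forall i : nat, exists P : 'rV[R]_n -> 'rV[R]_n,
      [/\ polymap P, forall y, (\rank ('J P y) <= \rank ('J f x))%N &
          forall y, `|y - x| <= eta -> `|P y - f y| <= i.+1%:R^-1].
    by move=> i; apply: approx; rewrite invr_gt0.
  have eb y : eball x (Num.min eta (d / 2)) y ->
      `|y - x| <= eta /\ `|y - x| <= d / 2.
    move=> yx; have := le_lt_trans (mx_norm_le_enorm _) yx.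
    by rewrite lt_min => /andP[/ltW ? /ltW ?].
  (* [eta] is the radius of approximation, and [d / 2] keeps the ball inside [G] by [Gn]. *)
  exists (Num.min eta (d / 2)), f_; split.
  - by rewrite lt_min eta0 divr_gt0.
  - by move=> y /eb[_]; exact: Gn.
  - by move=> i; apply: polymap_Coo; have [] := fE i.
  - by move=> i y _; have [_ /(_ y)/leq_trans + _] := fE i; apply; exact: hrank.
  - by apply: norm_cvg_uniform => i y /eb[yx _]; have [_ _] := fE i; apply.
Qed.
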